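(* Let $\mathbf{T}=(T,+,;,\rightarrow,0,1)$ be a complete residuated lattice satisfying $a;b=b;a$ for all $a,b\in T$, and let $X$ be a set. Then $\mathbf{FSET}(\mathbf{T})=(T^X,T^X,\cup,\otimes,{}^*,\rightarrow,\varnothing,\chi)$ is a graded Kleene algebra with tests (GKAT). If moreover $\mathbf{T}$ satisfies $a;a=a$ for all $a\in T$, then $\mathbf{FSET}(\mathbf{T})$ is an idempotent graded Kleene algebra with tests (I-GKAT).
   Context: A complete residuated lattice $\mathbf{T}=(T,+,;,\rightarrow,0,1)$ is a complete lattice on $T$ with binary join $+$ (arbitrary joins written $\sum$), least element $0$ and greatest element $1$, together with an associative multiplication $;$ having $1$ as two-sided unit and distributing over arbitrary joins on both sides ($a;\sum_i b_i=\sum_i a;b_i$ and $(\sum_i b_i);a=\sum_i b_i;a$), and a binary operation $\rightarrow$ such that $a;b\leq c\Leftrightarrow b\leq a\rightarrow c$. For a set $X$, $T^X$ is the set of functions $X\to T$ (fuzzy subsets of $X$), with pointwise operations: $(\varphi\cup\psi)(x)=\varphi(x)+\psi(x)$, $(\varphi\otimes\psi)(x)=\varphi(x);\psi(x)$, $(\varphi\rightarrow\psi)(x)=\varphi(x)\rightarrow\psi(x)$, $\varnothing(x)=0$, $\chi(x)=1$, and $\varphi^*(x)=\sum_{k\geq 0}\varphi^k(x)$ where $\varphi^0=\chi$ and $\varphi^{k+1}=\varphi^k\otimes\varphi$. A GKAT is a tuple $(K,T',+,;,{}^*,\rightarrow,0,1)$ where $K$ is a set, $T'\subseteq K$, $0,1\in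 T'$, $+$ and $;$ are binary operations on $K$ under which $T'$ is closed, ${}^*$ is unary on $K$, and $\rightarrow$ is a binary operation on $T'$ with values in $T'$, such that for all $p,q,r\in K$ and $a,b,c\in T'$: $p+(q+r)=(p+q)+r$; $p+q=q+p$; $p;(q;r)=(p;q);r$; $p;1=1;p=p$; $p;(q+r)=p;q+p;r$; $(p+q);r=p;r+q;r$; $p;0=0;p=0$; $1+p;p^*=p^*$; $q+p;r\leq r\Rightarrow p^*;q\leq r$; $q+r;p\leq r\Rightarrow q;p^*\leq r$; $a;b\leq c\Leftrightarrow b\leq a\rightarrow c$; $a\leq 1$; $a;b=b;a$, where $p\leq q$ means $p+q=q$. An I-GKAT is a GKAT additionally satisfying $a;a=a$ for all $a\in T'$. *)

(* Defs.v *)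
From HB Require Import structures.
From mathcomp Require Import all_boot all_order.
From mathcomp Require Import boolp classical_sets.

Set Implicit Arguments.
Unset Strict Implicit.
Unset Printing Implicit Defensive.

Import Order.TTheory.
Local Open Scope classical_set_scope.
Local Open Scope order_scope.

(* [supremum x0 A] is [x0] when [A] is empty, so the default [\bot] makes the
   empty join the least element. When [range f] has no least upper bound the
   value is [\bot]; this never happens in a complete lattice. *)
Definition joins d (T : tbLatticeType d) (I : Type) (f : I -> T) : T :=
  supremum \bot (range f).

HB.mixin Record TBLattice_isComplete d T of Order.TBLattice d T := {
  supremums_neq0 : forall A : set T, supremums A !=set0;
  infimums_neq0 : forall A : set T, infimums A !=set0
}.

#[short(type="completeLatticeType")]
HB.structure Definition CompleteLattice d :=
  { T of Order.TBLattice d T & TBLattice_isComplete d T }.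

HB.mixin Record CompleteLattice_isResiduated d T of CompleteLattice d T := {
  rmul : T -> T -> T;
  rimp : T -> T -> T;
  rmulA : associative rmul;
  rmul1l : left_id (\top : T) rmul;
  rmul1r : right_id (\top : T) rmul;
  rmul_joinsr : forall (a : T) (I : Type) (b : I -> T),
    rmul a (joins b) = joins (fun i => rmul a (b i));
  rmul_joinsl : forall (a : T) (I : Type) (b : I -> T),
    rmul (joins b) a = joins (fun i => rmul (b i) a);
  rmul_residual : forall a b c : T, (rmul a b <= c) <-> (b <= rimp a c)
}.

#[short(type="completeResiduatedLatticeType")]
HB.structure Definition CompleteResiduatedLattice d :=
  { T of CompleteLattice d T & CompleteLattice_isResiduated d T }.

(* The operation [gimp] is only meaningful on [gtests]: it is total here, but
   [is_gkat] constrains it on tests only. *)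
Record gkat_tuple := GkatTuple {
  gcarrier :> Type;
  gtests : set gcarrier;
  gadd : gcarrier -> gcarrier -> gcarrier;
  gmul : gcarrier -> gcarrier -> gcarrier;
  gstar : gcarrier -> gcarrier;
  gimp : gcarrier -> gcarrier -> gcarrier;
  gzero : gcarrier;
  gone : gcarrier
}.

Arguments gzero {g}.
Arguments gone {g}.

Definition gle (K : gkat_tuple) (p q : K) : Prop := gadd p q = q.

Record is_gkat (K : gkat_tuple) : Prop := IsGkat {
  gtests0 : gtests (gzero : K);
  gtests1 : gtests (gone : K);
  gtestsD : forall a b : K, gtests a -> gtests b -> gtests (gadd a b);
  gtestsM : forall a b : K, gtests a -> gtests b -> gtests (gmul a b);
  gtestsI : forall a b : K, gtests a -> gtests b -> gtests (gimp a b);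
  gaddA : forall p q r : K, gadd p (gadd q r) = gadd (gadd p q) r;
  gaddC : forall p q : K, gadd p q = gadd q p;
  gmulA : forall p q r : K, gmul p (gmul q r) = gmul (gmul p q) r;
  gmulr1 : forall p : K, gmul p gone = p;
  gmul1r : forall p : K, gmul gone p = p;
  gmulDr : forall p q r : K, gmul p (gadd q r) = gadd (gmul p q) (gmul p r);
  gmulDl : forall p q r : K, gmul (gadd p q) r = gadd (gmul p r) (gmul q r);
  gmulr0 : forall p : K, gmul p gzero = gzero;
  gmul0r : forall p : K, gmul gzero p = gzero;
  gstar_unfold : forall p : K, gadd gone (gmul p (gstar p)) = gstar p;
  gstar_indl : forall p q r : K,
    gle (gadd q (gmul p r)) r -> gle (gmul (gstar p) q) r;
  gstar_indr : forall p q r : K,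
    gle (gadd q (gmul r p)) r -> gle (gmul q (gstar p)) r;
  gimp_residual : forall a b c : K, gtests a -> gtests b -> gtests c ->
    (gle (gmul a b) c <-> gle b (gimp a c));
  gtests_le1 : forall a : K, gtests a -> gle a gone;
  gtests_mulC : forall a b : K, gtests a -> gtests b -> gmul a b = gmul b a
}.

Definition is_igkat (K : gkat_tuple) : Prop :=
  is_gkat K /\ (forall a : K, gtests a -> gmul a a = a).

Section FuzzySets.
Context d (T : completeResiduatedLatticeType d) (X : Type).
Implicit Types phi psi : X -> T.

Definition fuzzy_union phi psi : X -> T := fun x => phi x `|` psi x.
Definition fuzzy_mul phi psi : X -> T := fun x => rmul (phi x) (psi x).
Definition fuzzy_imp phi psi : X -> T := fun x => rimp (phi x) (psi x).
Definition fuzzy_empty : X -> T := fun=> \bot.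
Definition fuzzy_full : X -> T := fun=> \top.

Fixpoint fuzzy_pow phi (k : nat) : X -> T :=
  if k is k'.+1 then fuzzy_mul (fuzzy_pow phi k') phi else fuzzy_full.

Definition fuzzy_star phi : X -> T := fun x => joins (fun k => fuzzy_pow phi k x).

Definition FSET : gkat_tuple :=
  GkatTuple [set: X -> T] fuzzy_union fuzzy_mul fuzzy_star fuzzy_imp
    fuzzy_empty fuzzy_full.

End FuzzySets.

(* Main.v *)
Require Import Defs.
From HB Require Import structures.
From mathcomp Require Import all_boot all_order.
From mathcomp Require Import boolp classical_sets.

(** Since [phi^0] is the full set, [phi^*] is the greatest element of [T^X], so
    the star axioms hold trivially. The remaining semiring axioms are pointwise;
    distributivity and annihilation follow from residuation. *)

Import Order.TTheory.
Local Open Scope order_scope.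

Section ResiduatedLattice.
Context {d : Order.disp_t} {T : completeResiduatedLatticeType d}.
Implicit Types a b c : T.

(** Neither default [\bot] in [joins] is reached: the index [i] makes the range nonempty, and
    completeness provides a least upper bound for [xget] to pick. *)
Lemma le_joins {I : Type} (f : I -> T) (i : I) : f i <= joins f.
Proof.
have f_i : range f (f i) by exists i.
rewrite /joins /supremum; case: eqP => [f0|_]; first by rewrite f0 in f_i.
case: xgetP => [y _ [ub_y _]|no_sup]; first exact: ub_y.
by have [y /no_sup] := supremums_neq0 (range f).
Qed.

(** By residuation [rmul a] is left adjoint to [rimp a], so it preserves binary joins; no
    two-element family for [joins] has to be built. *)
Lemma rmulUr a b c : rmul a (b `|` c) = rmul a b `|` rmul a c.
Proof.
apply/le_anti/andP; split.
  by apply/rmul_residual; rewrite leUx; apply/andP; split;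
    apply/rmul_residual; rewrite ?leUl ?leUr.
(* This half is monotonicity of [rmul a], read off the unit of the adjunction. *)
by rewrite leUx; apply/andP; split;
  apply/rmul_residual; [apply: le_trans (leUl b c) _|apply: le_trans (leUr c b) _];
  apply/rmul_residual.
Qed.

Lemma rmulr0 a : rmul a \bot = \bot.
Proof. by apply/eqP; rewrite -lex0; apply/rmul_residual. Qed.

End ResiduatedLattice.

Section FuzzySets.
Context {d : Order.disp_t} {T : completeResiduatedLatticeType d} {X : Type}.
Implicit Type phi : X -> T.

Lemma gle_FSETP (phi psi : FSET T X) :
  gle phi psi <-> forall x, phi x <= psi x.
Proof.
split=> [phiU x|le_phi].
  by apply/join_idPr; exact: (f_equal (@^~ x) phiU).
by apply/funext => x; apply/join_idPr.
Qed.

Lemma fuzzy_starE phi : fuzzy_star phi = @fuzzy_full _ T X.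
Proof.
apply/funext => x; apply/eqP; rewrite -le1x.
(* The term at [k = 0] computes to [\top]. *)
exact: (le_joins (fun k => fuzzy_pow phi k x) 0).
Qed.

End FuzzySets.

Theorem theorem3 (d : Order.disp_t) (T : completeResiduatedLatticeType d)
    (X : Type) (rmulC : forall a b : T, rmul a b = rmul b a) :
  is_gkat (FSET T X) /\
  ((forall a : T, rmul a a = a) -> is_igkat (FSET T X)).
Proof.
have gkat_FSET : is_gkat (FSET T X).
  split=> //=.
  - by move=> p q r; apply/funext => x; apply: joinA.
  - by move=> p q; apply/funext => x; apply: joinC.
  - by move=> p q r; apply/funext => x; apply: rmulA.
  - by move=> p; apply/funext => x; apply: rmul1r.
  - by move=> p; apply/funext => x; apply: rmul1l.
  - by move=> p q r; apply/funext => x; apply: rmulUr.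
  - move=> p q r; apply/funext => x; rewrite /fuzzy_mul /fuzzy_union.
    (* The adjunction concerns the second factor only, so commutativity first moves [r x] to the
       left. *)
    by rewrite !(rmulC _ (r x)) rmulUr.
  - by move=> p; apply/funext => x; apply: rmulr0.
  - by move=> p; apply/funext => x; rewrite /fuzzy_mul rmulC; apply: rmulr0.
  - by move=> p; rewrite fuzzy_starE; apply/funext => x; apply: join1x.
  (* The star is now the unit, so both induction rules reduce to [q x <= r x], which the first
     joinand of the hypothesis gives. *)
  - move=> p q r /gle_FSETP le_r; rewrite fuzzy_starE; apply/gle_FSETP => x /=.
    rewrite /fuzzy_mul rmul1l; exact: le_trans (leUl _ _) (le_r x).
  - move=> p q r /gle_FSETP le_r; rewrite fuzzy_starE; apply/gle_FSETP => x /=.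
    rewrite /fuzzy_mul rmul1r; exact: le_trans (leUl _ _) (le_r x).
  - move=> a b c _ _ _; split=> /gle_FSETP le_abc; apply/gle_FSETP => x;
      apply/rmul_residual; exact: le_abc.
  - by move=> a _; apply/gle_FSETP => x; apply: lex1.
  - by move=> a b _ _; apply/funext => x; apply: rmulC.
split=> // rmulxx; split=> // a _.
by apply/funext => x; apply: rmulxx.
Qed.
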